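(* Let $\mathcal{A}=(A_i)_{i\in I}$ and $\mathcal{B}=(B_j)_{j\in J}$ be collections, with $I\neq\varnothing$ and $J\neq\varnothing$, of nonempty closed subsets of $X$ such that $A:=\bigcup_{i\in I}A_i$ and $B:=\bigcup_{j\in J}B_j$ are closed, and let $c\in A\cap B$. Let $\widetilde{\mathcal{A}}=(\widetilde A_i)_{i\in I}$ and $\widetilde{\mathcal{B}}=(\widetilde B_j)_{j\in J}$ be collections of nonempty subsets of $X$ such that $P_{A_i}((\operatorname{bdry}B)\smallsetminus A)\subseteq\widetilde A_i$ for every $i\in I$ and $P_{B_j}((\operatorname{bdry}A)\smallsetminus B)\subseteq\widetilde B_j$ for every $j\in J$. Set $\widetilde A:=\bigcup_{i\in I}\widetilde A_i$ and $\widetilde B:=\bigcup_{j\in J}\widetilde B_j$. Assume that $\mathcal{A}$ is $\widetilde B$-joint-superregular at $c$ and that $\mathcal{B}$ is $\widetilde A$-joint-superregular at $c$. Let $\overline\theta$ be the limiting joint-CQ-number and $\overline\alpha$ the exact joint-CQ-number at $c$ associated with $(\mathcal{A},\widetilde{\mathcal{A}},\mathcal{B},\widetilde{\mathcal{B}})$. Assume further that (a) $\overline\theta<1$, or (more restrictively) that (b) $I$ and $J$ are finite and $\overline\alpha<1$ (and hence $\overline\theta=\overline\alpha<1$). Let $\theta\in\,]\overline\theta,1[$ and $\varepsilon:=(\theta-\overline\theta)/3$. Then there exists $\delta>0$ such that (i) $\mathcal{A}$ is $(\widetilde B,\varepsilon,3\delta)$-joint-regular at $c$; (ii) $\mathcal{B}$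 is $(\widetilde A,\varepsilon,3\delta)$-joint-regular at $c$; and (iii) $\theta_{3\delta}<\overline\theta+\varepsilon=\theta-2\varepsilon<1-2\varepsilon$, where $\theta_{3\delta}$ is the joint-CQ-number at $c$ associated with $(\mathcal{A},\widetilde{\mathcal{A}},\mathcal{B},\widetilde{\mathcal{B}})$ and $3\delta$. Consequently, for such $\delta$, if the starting point $b_{-1}\in X$ satisfies $\|b_{-1}-c\|\leq\frac{(1-\theta)\delta}{6(2-\theta)}$, then any sequences $(a_n)_{n\in\mathbb N}$ and $(b_n)_{n\in\mathbb N}$ generated by the method of alternating projections with respect to $(A,B)$ with starting point $b_{-1}$ converge linearly with rate $\theta^2$ to some point $\bar c\in A\cap B$ with $\|\bar c-c\|\leq\delta$; in fact, $$(\forall n\geq1)\quad\max\{\|a_n-\bar c\|,\|b_n-\bar c\|\}\leq\frac{\delta}{2-\theta}\big(\theta^2\big)^{n-1}.$$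
   Context: $X$ is a Euclidean space (finite-dimensional real Hilbert space) with inner product $\langle\cdot,\cdot\rangle$ and norm $\|\cdot\|$. $\mathbb N=\{0,1,2,\dots\}$; $\operatorname{bdry}S$ is the boundary of $S$ in $X$. For $S\subseteq X$ nonempty, $\operatorname{cone}(S)=\{\rho s:\rho\geq0,\,s\in S\}$, and $\operatorname{cone}(\varnothing)=\{0\}$. For nonempty $C\subseteq X$, $d_C(x)=\inf_{y\in C}\|x-y\|$, $P_C(x)=\{y\in C:\|x-y\|=d_C(x)\}$ (set-valued projection), $P_C(S)=\bigcup_{x\in S}P_C(x)$, $P_C^{-1}(y)=\{x\in X: y\in P_C(x)\}$. Convention: $\sup\varnothing=-\infty$. Restricted normal cones: for nonempty $C,D\subseteq X$ and $x\in C$, the $D$-restricted proximal normal cone is $\widehat N_C^{D}(x)=\operatorname{cone}((D\cap P_C^{-1}(x))-x)$; the $D$-restricted normal cone $N_C^{D}(x)$ is the set of all $u$ for which there exist $x_n\in C$, $u_n\in\widehat N_C^D(x_n)$ with $x_n\to x$ and $u_n\to u$. If $x\notin C$, both are empty. CQ-numbers at $c$: for nonempty sets $C,\widetilde C,D,\widetilde D$ and $\delta>0$, $\theta_\delta(C,\widetilde C,D,\widetilde D)=\sup\{\langle u,v\rangle: u\in\widehat N_C^{\widetilde D}(x),\ v\in-\widehat N_D^{\widetilde C}(y),\ \|u\|\leq1,\ \|v\|\leq1,\ \|x-c\|\leq\delta,\ \|y-c\|\leq\delta\}$ and $\overline\alpha(C,\widetilde C,D,\widetilde D)=\sup\{\langle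 u,v\rangle: u\in N_C^{\widetilde D}(c),\ v\in-N_D^{\widetilde C}(c),\ \|u\|\leq1,\ \|v\|\leq1\}$. The joint-CQ-number at $c$ associated with $(\mathcal A,\widetilde{\mathcal A},\mathcal B,\widetilde{\mathcal B})$ and $\delta$ is $\theta_\delta=\sup_{(i,j)\in I\times J}\theta_\delta(A_i,\widetilde A_i,B_j,\widetilde B_j)$; the limiting joint-CQ-number is $\overline\theta=\lim_{\delta\downarrow0}\theta_\delta$; the exact joint-CQ-number is $\overline\alpha=\sup_{(i,j)\in I\times J}\overline\alpha(A_i,\widetilde A_i,B_j,\widetilde B_j)$. Regularity: for nonempty $D,E\subseteq X$, $\varepsilon\geq0$, $\delta>0$, the set $D$ is $(E,\varepsilon,\delta)$-regular at $c$ if $\langle u,y-b\rangle\leq\varepsilon\|u\|\,\|y-b\|$ whenever $y,b\in D$, $\|y-c\|\leq\delta$, $\|b-c\|\leq\delta$, $u\in\widehat N_D^{E}(b)$. The set $D$ is $E$-superregular at $c$ if for every $\varepsilon>0$ there exists $\delta>0$ such that $D$ is $(E,\varepsilon,\delta)$-regular at $c$. A collection is $(E,\varepsilon,\delta)$-joint-regular at $c$ if each of its members is $(E,\varepsilon,\delta)$-regular at $c$. A collection is $E$-joint-superregular at $c$ if each of its members is $E$-superregular at $c$. Method of alternating projections (MAP) for $(A,B)$ with starting point $b_{-1}\in X$: any sequences with $a_n\in P_A(b_{n-1})$ and $b_n\in P_B(a_n)$ for all $n\in\mathbb N$. A sequence $(x_n)$ converges linearly to $\bar x$ with rate $\gamma\in[0,1[$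 if there is $\mu\geq0$ with $\|x_n-\bar x\|\leq\mu\gamma^n$ for all $n\in\mathbb N$.
   Formalization: Existence of δ with (i)–(iii) is claimed only if I is finite or 𝒜 is superregular with one δ for all members, and likewise for J and ℬ; without this it is false (A_t={0,t}, t∈ℝ; B=ℝ; c=0). The convergence claim is unchanged for every δ satisfying (i)–(iii). *)

(* Defs.v *)
From HB Require Import structures.
From mathcomp Require Import all_boot all_order all_algebra sesquilinear.
From mathcomp Require Import all_classical all_reals all_analysis.

Set Implicit Arguments.
Unset Strict Implicit.
Unset Printing Implicit Defensive.

Import Order.TTheory GRing.Theory Num.Theory.
Import numFieldNormedType.Exports.

Local Open Scope classical_set_scope.
Local Open Scope ring_scope.

#[short(type="normedVectType")]
HB.structure Definition NormedVector (R : numDomainType) :=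
  {V of NormedModule R V & Vector R V}.

(* A Euclidean space is a [normedVectType R] whose norm comes from the inner
   product [dot], so that the library topology is the Euclidean one. *)
Definition norm_of_dot (R : realType) (X : normedVectType R)
    (dot : {dot X for idfun}) : Prop :=
  forall x : X, dot x x = `|x| ^+ 2.

Section Sets.
Variables (R : realType) (X : normedVectType R).
Implicit Types (C D S : set X) (x y : X).

Definition bdry S : set X := closure S `\` interior S.

Definition cone S : set X :=
  [set z | (S = set0 /\ z = 0) \/
           exists rho : R, exists s : X, [/\ 0 <= rho, S s & z = rho *: s]].

Definition dist C x : R := inf [set `|x - y| | y in C].

Definition proj C x : set X := [set y | C y /\ `|x - y| = dist C x].

Definition proj_set C S : set X := \bigcup_(x in S) proj C x.

Definition proj_inv C y : set X := [set x | proj C x y].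

(* The conjunct [C x] is needed: [cone set0] is [[set 0]], whereas the normal
   cones are empty at points outside [C]. *)
Definition prox_normal C D x : set X :=
  [set u | C x /\ cone [set z - x | z in D `&` proj_inv C x] u].

Definition normal_cone C D x : set X :=
  [set u | C x /\ exists xn : nat -> X, exists un : nat -> X,
     [/\ forall n, C (xn n), forall n, prox_normal C D (xn n) (un n),
         xn @ \oo --> x & un @ \oo --> u]].

End Sets.

Section CQNumbers.
Variables (R : realType) (X : normedVectType R) (dot : {dot X for idfun}).
Variable c : X.

(* [v] ranges over [- N], that is, [- v \in N]. *)
Definition cq_number (C C' D D' : set X) (delta : R) : \bar R :=
  ereal_sup [set r | exists x y u v : X,
    [/\ prox_normal C D' x u, prox_normal D C' y (- v),
        `|u| <= 1 /\ `|v| <= 1,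
        `|x - c| <= delta /\ `|y - c| <= delta & r = (dot u v)%:E]].

Definition exact_cq_number (C C' D D' : set X) : \bar R :=
  ereal_sup [set r | exists u v : X,
    [/\ normal_cone C D' c u, normal_cone D C' c (- v),
        `|u| <= 1, `|v| <= 1 & r = (dot u v)%:E]].

Variables (I J : Type) (A A' : I -> set X) (B B' : J -> set X).

Definition joint_cq_number (delta : R) : \bar R :=
  ereal_sup [set cq_number (A p.1) (A' p.1) (B p.2) (B' p.2) delta
            | p in [set: I * J]].

Definition lim_joint_cq_number : \bar R :=
  lim (joint_cq_number delta @[delta --> 0^'+]).

Definition exact_joint_cq_number : \bar R :=
  ereal_sup [set exact_cq_number (A p.1) (A' p.1) (B p.2) (B' p.2)
            | p in [set: I * J]].

End CQNumbers.

Section Regularity.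
Variables (R : realType) (X : normedVectType R) (dot : {dot X for idfun}).

Definition regular (D E : set X) (eps delta : R) (c : X) : Prop :=
  forall y b u : X, D y -> D b -> `|y - c| <= delta -> `|b - c| <= delta ->
    prox_normal D E b u -> dot u (y - b) <= eps * `|u| * `|y - b|.

Definition superregular (D E : set X) (c : X) : Prop :=
  forall eps : R, 0 < eps ->
    exists2 delta : R, 0 < delta & regular D E eps delta c.

Variable (I : Type) (A : I -> set X).

Definition joint_regular (E : set X) (eps delta : R) (c : X) : Prop :=
  forall i, regular (A i) E eps delta c.

Definition joint_superregular (E : set X) (c : X) : Prop :=
  forall i, superregular (A i) E c.

(* [delta] is common to all members. This is [joint_superregular] when [I] is
   finite, but it is strictly stronger in general: the sets [{0, t}], with [t]
   real, are all superregular at 0 without being uniformly so. *)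
Definition uniformly_joint_superregular (E : set X) (c : X) : Prop :=
  forall eps : R, 0 < eps ->
    exists2 delta : R, 0 < delta & joint_regular E eps delta c.

End Regularity.

Section AlternatingProjections.
Variables (R : realType) (X : normedVectType R).

(* [start] is the point with index -1 of the sequence [b]. *)
Definition alternating_projections (A B : set X) (start : X)
    (a b : nat -> X) : Prop :=
  forall n, proj A (if n is m.+1 then b m else start) (a n)
         /\ proj B (a n) (b n).

Definition converges_linearly (x : nat -> X) (xbar : X) (gamma : R) : Prop :=
  0 <= gamma < 1 /\
  exists2 mu : R, 0 <= mu & forall n, `|x n - xbar| <= mu * gamma ^+ n.

End AlternatingProjections.

(* Main.v *)
Require Import Defs.
From HB Require Import structures.
From mathcomp Require Import all_boot all_order all_algebra sesquilinear.
From mathcomp Require Import all_classical all_reals all_analysis.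
From mathcomp Require Import ring lra.

Import Order.TTheory GRing.Theory Num.Theory.
Import numFieldNormedType.Exports.

Local Open Scope classical_set_scope.
Local Open Scope ring_scope.

(** Near [c] each projection step of the method contracts the distance between
    consecutive iterates by the factor [theta], so the iterates form a sequence
    with geometrically decreasing increments and converge.

    The contraction is a statement about one triple: [p] in the first union,
    [q] a projection of [p] on the second, [r] a projection of [q] on the first.
    Let [p] belong to the member [A i] and [q] to the member [B j], and let [p']
    be a projection of [q] on [A i], the member that contains [p] rather than
    one that contains [r]. Then [q - p'] is a proximal normal to [A i] at [p']
    and [p - q] is one to [B j] at [q], and
      |q - p'|^2 = - <q - p', p - q> + <q - p', p - p'>.
    The joint-CQ-number bounds the first term by [kappa |q - p'| |p - q|];
    regularity of [A i], which contains both [p] and [p'], bounds the second by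
    [eps |q - p'| |p - p'|], and [|p - p'| <= 2 |p - q|]. Hence
      |q - r| <= |q - p'| <= (kappa + 2 eps) |p - q|,
    which is [member_contraction]. These normals are restricted ones, so [p] must
    lie in [A' i] and [q] in [B' j]; for this, [p] and [q] have to be projections
    of boundary points outside the target union. A point that is a projection of
    a point outside a set lies on the boundary of that set, so two earlier
    iterates of the method suffice, unless some iterate already lies in both
    unions, in which case the method has stopped
    ([alternating_contraction]). This is why the rate is guaranteed only from
    [a 1] on: the starting point is arbitrary.

    With [kappa = theta - 2 eps], the interleaved sequence [a 1], [b 1], [a 2],
    ... has increments shrinking by [theta], and the smallness of
    [start - c] keeps it within [delta] of [c], where the contraction applies;
    [geometric_sequence] gives the limit and [alternating_projections_cvg] the
    error bounds.

    The identity of the limiting and exact joint-CQ-numbers for finite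
    collections rests on compactness of balls: normal pairs at points that tend
    to [c] have a convergent subsequence, whose limit is a pair of limiting
    normals ([cq_number_le_exact]); conversely limiting normals are, by
    definition, limits of proximal ones ([exact_cq_number_le]). Finiteness is
    used to take one radius for all pairs of members. *)

Local Notation proj := Defs.proj.

Set Implicit Arguments.
Unset Strict Implicit.
Unset Printing Implicit Defensive.

(** * Compactness of closed balls *)

Section Compactness.
Variables (R : realType) (X : normedVectType R).

Import VectorInternalTheory.

Lemma sum_coord_continuous (V : normedModType R) n (e : 'I_n -> V) :
  continuous (fun u : 'rV[R]_n => \sum_i u ord0 i *: e i).
Proof.
move=> u; rewrite /continuous_at; elim: (index_enum _) => [|i s IHs].
  rewrite big_nil; under eq_fun do rewrite big_nil.
  exact (@cst_continuous _ V 0 u).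
rewrite big_cons; under eq_fun do rewrite big_cons.
have h1 : (fun x : 'rV[R]_n => x ord0 i *: e i) x @[x --> u] --> u ord0 i *: e i.
  exact: (cvgZr_tmp (@coord_continuous _ _ _ ord0 i u)).
exact: (cvgD h1 IHs).
Qed.

Lemma r2v_continuous : continuous (r2v : 'rV[R]_(dim X) -> X).
Proof.
rewrite (_ : r2v = fun u : 'rV[R]_(dim X) =>
    \sum_i u ord0 i *: (r2v (delta_mx ord0 i) : X)).
  exact: sum_coord_continuous.
apply: funext => u; rewrite [in LHS](row_sum_delta u) linear_sum.
by apply: eq_bigr => i _; rewrite linearZ.
Qed.

(** The norm of [X] and the sup norm of coordinates are comparable: the
    continuous function [|r2v y|] is positive, hence bounded away from 0, on the
    compact unit sphere of coordinate vectors. *)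
Lemma norm_le_r2v :
  exists2 M : R, 0 <= M & forall y : 'rV[R]_(dim X), `|y| <= M * `|r2v y : X|.
Proof.
set S := [set y : 'rV[R]_(dim X) | `|y| = 1].
have rnorm_cts : continuous (fun y : 'rV[R]_(dim X) => `|r2v y : X|).
  move=> y; apply: continuous_comp; first exact: r2v_continuous.
  exact: norm_continuous.
have cS : compact S.
  apply: bounded_closed_compact.
    by exists 1; split => // x x1 y /= ->; apply/ltW.
  apply: (@preimage_closed _ _ (fun y : 'rV[R]_(dim X) => `|y|) [set 1]);
    [by move=> y _; exact: norm_continuous|exact: closed_eq].
(* the sphere is empty when the dimension is 0, and then [y = 0] *)
have [S0|S0] := pselect (S !=set0); last first.
  exists 0 => // y; rewrite mul0r.
  have [->|y0] := eqVneq y 0; first by rewrite normr0.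
  exfalso; apply: S0; exists (`|y|^-1 *: y); rewrite /S /=.
  by rewrite normrZ normfV normr_id mulVf// normr_eq0.
have [|y /[!inE] Sy ymin] :=
    compact_EVT_min S0 cS (f := fun y : 'rV[R]_(dim X) => `|r2v y : X|).
  exact: continuous_subspaceT.
have ry0 : 0 < `|r2v y : X|.
  rewrite normr_gt0; apply/eqP => ry.
  have : y = 0 by rewrite -(r2vK y) ry linear0.
  by move: Sy => /[swap] -> /=; rewrite /S /= normr0 => /esym/eqP; rewrite oner_eq0.
exists `|r2v y : X|^-1; first by rewrite invr_ge0 ltW.
move=> z; have [->|z0] := eqVneq z 0; first by rewrite normr0 mulr_ge0// invr_ge0 ltW.
rewrite mulrC ler_pdivlMr// mulrC -ler_pdivlMr ?normr_gt0//.
have := ymin (`|z|^-1 *: z); rewrite linearZ normrZ normfV normr_id mulrC; apply.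
by rewrite inE /S /= normrZ normfV normr_id mulVf// normr_eq0.
Qed.

Lemma closed_norm_le (c : X) (r : R) : closed [set x : X | `|x - c| <= r].
Proof.
apply: (@preimage_closed _ _ (fun x : X => `|x - c|) [set y | y <= r]);
  last exact: closed_le.
move=> x _; apply: cvg_norm.
exact: (cvgB cvg_id (cvg_cst c)).
Qed.

(** The ball is a closed subset of the continuous image under [r2v] of a ball of
    coordinate vectors. *)
Lemma compact_norm_le (c : X) (r : R) : compact [set x : X | `|x - c| <= r].
Proof.
have [M M0 hM] := norm_le_r2v.
set K := [set y : 'rV[R]_(dim X) | `|y| <= M * (r + `|c|)].
have cK : compact (r2v @` K : set X).
  apply: continuous_compact.
    by apply: continuous_subspaceT; exact: r2v_continuous.
  apply: bounded_closed_compact.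
    exists (M * (r + `|c|)); split; first exact: num_real.
    by move=> x /ltW xM y /= /le_trans; apply.
  apply: (@preimage_closed _ _ (fun y : 'rV[R]_(dim X) => `|y|) [set y | y <= _]);
    last exact: closed_le.
  by move=> y _; exact: norm_continuous.
apply: (subclosed_compact (@closed_norm_le c r) cK).
move=> x /= xr; exists (v2r x); last exact: v2rK.
rewrite /K /=; apply: (le_trans (hM _)); rewrite v2rK ler_wpM2l//.
by rewrite -[x in leLHS](subrK c) (le_trans (ler_normD _ _))// lerD2r.
Qed.

End Compactness.

(** * Projections and proximal normals *)

Section Projections.
Variables (R : realType) (X : normedVectType R).
Implicit Types (C D : set X) (x y z u : X).

Lemma projP C x y :
  proj C x y <-> C y /\ forall z, C z -> `|x - y| <= `|x - z|.
Proof.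
have lb : has_lbound [set `|x - z| | z in C].
  by exists 0 => _ [z _ <-]; exact: normr_ge0.
split=> [[Cy yE]|[Cy ymin]]; split=> //.
  by move=> z Cz; rewrite yE; apply: ge_inf => //; exists z.
apply/eqP; rewrite eq_le; apply/andP; split; last by apply: ge_inf => //; exists y.
by apply: lb_le_inf => [|_ [z Cz <-]]; [exists `|x - y|, y|exact: ymin].
Qed.

Lemma proj_exists C x : C !=set0 -> closed C -> exists y, proj C x y.
Proof.
move=> [y0 Cy0] cC; set K := C `&` [set y | `|y - x| <= `|y0 - x|].
have cK : compact K by rewrite /K setIC; apply: compact_closedI => //; exact: compact_norm_le.
have [||y /[!inE] -[Cy yK] ymin] :=
    @compact_EVT_min _ _ (fun y : X => `|y - x|) K _ cK.
- by exists y0; split => /=.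
- apply: continuous_subspaceT => y; apply: cvg_norm.
  exact: (cvgB cvg_id (cvg_cst x)).
exists y; apply/projP; split=> // z Cz; rewrite ![`|x - _|]distrC.
have [zK|/ltW zK] := leP `|z - x| `|y0 - x|; last exact: le_trans zK.
by apply: ymin; rewrite inE.
Qed.

Lemma proj_id C x y : C x -> proj C x y -> y = x.
Proof.
move=> Cx /projP[_ /(_ x Cx)]; rewrite subrr normr0 normr_le0 subr_eq0.
by move/eqP.
Qed.

Lemma proj_subset C D x y : C `<=` D -> C y -> proj D x y -> proj C x y.
Proof.
by move=> CD Cy /projP[_ ymin]; apply/projP; split => // z /CD; exact: ymin.
Qed.

(** At an interior point of [C] one could move a little towards [x] inside [C]
    and come closer to [x]. *)
Lemma proj_bdry C x y : ~ C x -> proj C x y -> bdry C y.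
Proof.
move=> nCx /projP[Cy ymin]; split; first exact: subset_closure.
move=> /nbhs_ballP[e /= e0 eC].
have d0 : 0 < `|x - y|.
  by rewrite normr_gt0 subr_eq0; apply/eqP => xy; apply: nCx; rewrite xy.
set d := `|x - y| in d0; have de0 : 0 < d + e by rewrite addr_gt0.
(* [t] is small enough for the point to lie in the ball of radius [e] *)
set t := e / (d + e).
have t0 : 0 < t by rewrite divr_gt0.
have t1 : t < 1 by rewrite ltr_pdivrMr// mul1r ltrDr.
have /ymin : C (y + t *: (x - y)).
  apply: eC; rewrite -ball_normE /= opprD addNKr normrN normrZ gtr0_norm//.
  by rewrite mulrAC ltr_pdivrMr// -/d mulrDr ltr_pwDr// mulr_gt0.
rewrite opprD addrA -[X in X - t *: _]scale1r -scalerBl normrZ gtr0_norm ?subr_gt0//.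
by rewrite -/d leNgt gtr_pMl// ltrBlDr ltrDl t0.
Qed.

(** Separates the zero normal, so that the case split of [cone] on an empty
    generating set need not be repeated. *)
Lemma prox_normalP C D x u : prox_normal C D x u <->
  C x /\ (u = 0 \/ exists rho : R, exists z,
    [/\ 0 <= rho, D z, proj C z x & u = rho *: (z - x)]).
Proof.
split=> -[Cx].
  case=> [[_ ->]|[rho [_ [rho0 [z [Dz zx] <-] ->]]]]; split=> //; first by left.
  by right; exists rho, z.
move=> uE; split=> //; have [S0|S0] := eqVneq [set z - x | z in D `&` proj_inv C x] set0.
  left; split => //; case: uE => // -[rho [z [_ Dz zx _]]].
  by have : set0 (z - x) by rewrite -S0; exists z.
right; case: uE => [->|[rho [z [rho0 Dz zx ->]]]].
  by have /set0P[s Ss] := S0; exists 0, s; rewrite scale0r.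
by exists rho, (z - x); split => //; exists z.
Qed.

Lemma prox_normal0 C D x : C x -> prox_normal C D x 0.
Proof. by move=> Cx; apply/prox_normalP; split; [|left]. Qed.

Lemma prox_normal_proj C D x z : D z -> proj C z x -> prox_normal C D x (z - x).
Proof.
move=> Dz zx; apply/prox_normalP; split; first by case: zx.
by right; exists 1, z; rewrite scale1r.
Qed.

Lemma prox_normalZ C D x u (r : R) :
  0 <= r -> prox_normal C D x u -> prox_normal C D x (r *: u).
Proof.
move=> r0 /prox_normalP[Cx uE]; apply/prox_normalP; split => //.
case: uE => [->|[rho [z [rho0 Dz zx ->]]]]; first by left; rewrite scaler0.
by right; exists (r * rho), z; rewrite scalerA mulr_ge0.
Qed.

Lemma prox_normal_subset C D D' x :
  D `<=` D' -> prox_normal C D x `<=` prox_normal C D' x.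
Proof.
move=> DD' u /prox_normalP[Cx uE]; apply/prox_normalP; split => //.
case: uE => [|[rho [z [rho0 /DD' Dz zx ->]]]]; first by left.
by right; exists rho, z.
Qed.

End Projections.

(** * The inner product *)

Section InnerProduct.
Variables (R : realType) (X : normedVectType R) (dot : {dot X for idfun}).
Hypothesis hdot : norm_of_dot dot.

Lemma dotC (u v : X) : dot u v = dot v u.
Proof. by rewrite hermC expr0 mul1r. Qed.

Lemma dotZl (a : R) (u v : X) : dot (a *: u) v = a * dot u v.
Proof. exact: linearZl_LR. Qed.

Lemma dotZr (a : R) (u v : X) : dot u (a *: v) = a * dot u v.
Proof. exact: linearZr_LR. Qed.

Lemma dotDr (u v w : X) : dot u (v + w) = dot u v + dot u w.
Proof. exact: linearDr. Qed.

Lemma dotDl (u v w : X) : dot (u + v) w = dot u w + dot v w.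
Proof. exact: linearDl. Qed.

Lemma dotBr (u v w : X) : dot u (v - w) = dot u v - dot u w.
Proof. exact: linearBr. Qed.

Lemma dotBl (u v w : X) : dot (u - v) w = dot u w - dot v w.
Proof. exact: linearBl. Qed.

Lemma cauchy_schwarz (u v : X) : dot u v <= `|u| * `|v|.
Proof.
have [->|u0] := eqVneq u 0; first by rewrite linear0l normr0 mul0r.
have [->|v0] := eqVneq v 0; first by rewrite linear0r normr0 mulr0.
have uv0 : 0 < `|u| * `|v| by rewrite mulr_gt0 ?normr_gt0.
(* this vector vanishes when [u] and [v] are positively collinear *)
have : 0 <= dot (`|v| *: u - `|u| *: v) (`|v| *: u - `|u| *: v).
  by rewrite hdot exprn_ge0.
rewrite !(dotBl, dotBr, dotZl, dotZr) !hdot (dotC v u) => h.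
rewrite -(ler_pM2l uv0); nra.
Qed.

Lemma dot_polar (u v : X) : dot u v = (`|u + v| ^+ 2 - `|u - v| ^+ 2) / 4.
Proof.
by rewrite -!hdot !(dotBl, dotDl, dotDr, dotBr) (dotC v u); field.
Qed.

(** Polarization reduces the continuity of [dot] to that of the norm. *)
Lemma cvg_dot (T : Type) (F : set_system T) {FF : Filter F} (f g : T -> X) u v :
  f x @[x --> F] --> u -> g x @[x --> F] --> v ->
  dot (f x) (g x) @[x --> F] --> dot u v.
Proof.
move=> fu gv; rewrite dot_polar; under eq_fun do rewrite dot_polar.
apply: cvgMr_tmp; apply: cvgB; rewrite expr2; under eq_fun do rewrite expr2.
  by apply: cvgM; apply: cvg_norm; exact: (cvgD fu gv).
by apply: cvgM; apply: cvg_norm; exact: (cvgB fu gv).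
Qed.

End InnerProduct.

(** * CQ-numbers of a pair of sets *)

Lemma cluster_subseq (R : realType) (V : normedModType R) (f : nat -> V) p :
  cluster (f @ \oo) p ->
  exists2 phi : nat -> nat, (forall k, (k <= phi k)%N) &
    f (phi k) @[k --> \oo] --> p.
Proof.
move=> clp; have ex k : exists n, (k <= n)%N /\ `|p - f n| < k.+1%:R^-1.
  have [] := clp [set f n | n in [set n | (k <= n)%N]] (ball p k.+1%:R^-1).
  - by exists k => // n /= kn; exists n.
  - by apply: nbhsx_ballx; rewrite invr_gt0.
  by move=> _ [[n kn <-]]; rewrite -ball_normE /=; exists n.
have [phi phiP] := choice ex.
exists phi => [k|]; first by case: (phiP k).
apply/cvgrPdist_lt => e e0; near=> k.
apply: (lt_trans (phiP k).2).
by near: k; exact: near_infty_natSinv_lt (PosNum e0).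
Unshelve. all: by end_near. Qed.

Section JointCQ.
Variables (R : realType) (X : normedVectType R) (dot : {dot X for idfun}).
Hypothesis hdot : norm_of_dot dot.
Variable c : X.

(** The bound that a CQ-number at most [kappa] puts on normals of any length. The
    second normal [w] points out of [D], so that [- w] is the [v] of the
    CQ-number; in this form the condition is symmetric in the two sets. *)
Definition angle_bound (C C' D D' : set X) (kappa delta : R) : Prop :=
  forall x y u w, prox_normal C D' x u -> prox_normal D C' y w ->
    `|x - c| <= delta -> `|y - c| <= delta ->
    - dot u w <= kappa * `|u| * `|w|.

Lemma cq_number_leP C C' D D' (kappa delta : R) : 0 <= kappa ->
  (cq_number dot c C C' D D' delta <= kappa%:E)%E <->
  angle_bound C C' D D' kappa delta.
Proof.
move=> k0; split=> [cqk x y u w nu nw xc yc|bnd]; last first.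
  apply/ereal_supP => _ [x [y [u [v [nu nv [u1 v1] [xc yc] ->]]]]].
  rewrite lee_fin; have := bnd _ _ _ _ nu nv xc yc.
  rewrite linearNr opprK normrN => /le_trans; apply.
  by rewrite -mulrA ler_piMr// mulr_ile1.
have [->|u0] := eqVneq u 0; first by rewrite linear0l oppr0 normr0 mulr0 mul0r.
have [->|w0] := eqVneq w 0; first by rewrite linear0r oppr0 normr0 mulr0.
have nu0 : 0 < `|u| by rewrite normr_gt0.
have nw0 : 0 < `|w| by rewrite normr_gt0.
have : ((dot (`|u|^-1 *: u) (`|w|^-1 *: - w))%:E <= kappa%:E)%E.
  apply: (le_trans _ cqk); apply: ereal_sup_ubound.
  exists x, y, (`|u|^-1 *: u), (`|w|^-1 *: - w); split=> //.
  - by apply: prox_normalZ => //; rewrite invr_ge0 ltW.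
  - by rewrite scalerN opprK; apply: prox_normalZ => //; rewrite invr_ge0 ltW.
  - by rewrite !normrZ !normfV !normr_id normrN !mulVf ?gt_eqF.
rewrite lee_fin dotZl dotZr linearNr => h.
have := ler_wpM2l (ltW (mulr_gt0 nu0 nw0)) h.
have -> : `|u| * `|w| * (`|u|^-1 * (`|w|^-1 * - dot u w)) = - dot u w.
  by field; rewrite !gt_eqF.
by rewrite mulrC mulrA.
Qed.

Lemma cq_number_mono C C' D D' :
  {homo cq_number dot c C C' D D' : d e / d <= e >-> (d <= e)%E}.
Proof.
move=> d e de; apply: ereal_sup_le => _ [x [y [u [v [nu nv uv1 [xc yc] ->]]]]].
by exists x, y, u, v; split => //; split; exact: le_trans de.
Qed.

(** Otherwise there would be, at points tending to [c], normal pairs of norm at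
    most 1 with inner product greater than [s]; a subsequence of them converges
    to a pair of limiting normals at [c], whose inner product is at least [s]. *)
Lemma cq_number_le_exact C C' D D' (s : R) :
  closed C -> closed D -> (exact_cq_number dot c C C' D D' < s%:E)%E ->
  exists2 delta, 0 < delta & (cq_number dot c C C' D D' delta <= s%:E)%E.
Proof.
move=> cC cD exs; apply: contrapT => nodelta.
have ex n : exists p : (X * X) * (X * X),
    [/\ prox_normal C D' p.1.1 p.2.1, prox_normal D C' p.1.2 (- p.2.2),
     `|p.2.1| <= 1 /\ `|p.2.2| <= 1,
     `|p.1.1 - c| <= n.+1%:R^-1 /\ `|p.1.2 - c| <= n.+1%:R^-1
     & s < dot p.2.1 p.2.2].
  have /ereal_sup_gt[_ [x [y [u [v [nu nv uv1 xyc ->]]]]]] :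
      (s%:E < cq_number dot c C C' D D' n.+1%:R^-1)%E.
    rewrite ltNge; apply/negP => les; apply: nodelta.
    by exists n.+1%:R^-1; rewrite ?invr_gt0.
  by rewrite lte_fin => sd; exists ((x, y), (u, v)).
have [p pP] := choice ex.
have cK := compact_setX (@compact_norm_le _ X 0 1) (@compact_norm_le _ X 0 1).
have [|[u v] [[/= u1 v1] cl]] := cK ((p n).2 @[n --> \oo]) _.
  by exists 0 => // n _ /=; rewrite !subr0; case: (pP n).
have [phi phi_ge phi_cvg] := @cluster_subseq R (X * X)%type (fun n => (p n).2) _ cl.
have uvn : (p (phi k)).2.1 @[k --> \oo] --> u /\ (p (phi k)).2.2 @[k --> \oo] --> v.
  split; first exact: (cvg_comp (fun k => (p (phi k)).2) fst phi_cvg cvg_fst).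
  exact: (cvg_comp (fun k => (p (phi k)).2) snd phi_cvg cvg_snd).
have xyn : (p (phi k)).1.1 @[k --> \oo] --> c /\ (p (phi k)).1.2 @[k --> \oo] --> c.
  have small k : (phi k).+1%:R^-1 <= k.+1%:R^-1 :> R.
    by rewrite lef_pV2 ?posrE// ler_nat ltnS.
  split; apply/cvgrPdist_lt => e e0; near=> k; rewrite distrC.
    apply: (@le_lt_trans _ _ k.+1%:R^-1).
      by apply: le_trans (small k); case: (pP (phi k)) => _ _ _ [].
    by near: k; exact: near_infty_natSinv_lt (PosNum e0).
  apply: (@le_lt_trans _ _ k.+1%:R^-1).
    by apply: le_trans (small k); case: (pP (phi k)) => _ _ _ [].
  by near: k; exact: near_infty_natSinv_lt (PosNum e0).
have Cc : C c.
  apply: (closed_cvg C cC _ _ xyn.1); near=> k.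
  by case: (pP (phi k)) => -[].
have Dc : D c.
  apply: (closed_cvg D cD _ _ xyn.2); near=> k.
  by case: (pP (phi k)) => _ -[].
move: exs; apply/negP; rewrite -leNgt; apply: (@le_trans _ _ (dot u v)%:E).
  have dotn : dot (p (phi k)).2.1 (p (phi k)).2.2 @[k --> \oo] --> dot u v.
    by apply: (cvg_dot hdot); [exact: uvn.1|exact: uvn.2].
  rewrite lee_fin; apply: (closed_cvg [set r | s <= r] (@closed_ge _ s) _ _ dotn).
  by near=> k; apply: ltW; case: (pP (phi k)).
apply: ereal_sup_ubound; exists u, v; rewrite -(subr0 u) -(subr0 v); split => //; rewrite !subr0.
- split => //; exists (fun k => (p (phi k)).1.1), (fun k => (p (phi k)).2.1).
  split; [| |exact: xyn.1|exact: uvn.1] => n;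
    by case: (pP (phi n)) => // -[].
- split => //; exists (fun k => (p (phi k)).1.2), (fun k => - (p (phi k)).2.2).
  split; [| |exact: xyn.2|by apply: cvgN; exact: uvn.2] => n;
    by case: (pP (phi n)) => // _ -[].
Unshelve. all: by end_near. Qed.

(** Limiting normals are limits of proximal normals at nearby points. *)
Lemma exact_cq_number_le C C' D D' (delta kappa : R) : 0 <= kappa -> 0 < delta ->
  angle_bound C C' D D' kappa delta ->
  (exact_cq_number dot c C C' D D' <= kappa%:E)%E.
Proof.
move=> k0 d0 bnd; apply/ereal_supP => _ [u [v [nu nv u1 v1 ->]]].
have [_ [xn [un [_ nun xnc unu]]]] := nu.
have [_ [yn [wn [_ nwn ync wnv]]]] := nv.
have near_c (z : nat -> X) : z n @[n --> \oo] --> c ->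
    \forall n \near \oo, `|z n - c| <= delta.
  move=> /cvgrPdist_le/(_ _ d0) zc; near=> n; rewrite distrC.
  by near: n; exact: zc.
rewrite lee_fin; apply: (@le_trans _ _ (kappa * `|u| * `|v|)); last first.
  by rewrite -mulrA ler_piMr// mulr_ile1.
rewrite -(opprK (dot u v)) -linearNr -(normrN v).
have lhs : - dot (un n) (wn n) @[n --> \oo] --> - dot u (- v).
  by apply: cvgN; exact: cvg_dot.
have rhs : kappa * `|un n| * `|wn n| @[n --> \oo] --> kappa * `|u| * `|- v|.
  by apply: cvgM; [apply: cvgMl_tmp|]; exact: cvg_norm.
apply: (ler_cvg_to lhs rhs); near=> n.
apply: (bnd (xn n) (yn n)) => //; near: n; exact: near_c.
Unshelve. all: by end_near. Qed.

End JointCQ.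

(** * Joint-CQ-numbers *)

Lemma near_finite_forall (T K : Type) (F : set_system T) (FF : Filter F)
    (P : K -> T -> Prop) : finite_set [set: K] ->
  (forall i, \forall x \near F, P i x) -> \forall x \near F, forall i, P i x.
Proof.
move=> [n /card_set_bijP[f [fn finj _]]] PF.
suff : \forall x \near F, forall k : 'I_n, forall i, f i = k -> P i x.
  by apply: filterS => x Px i; exact: (Px (Ordinal (fn i Logic.I)) i erefl).
apply: filter_forall => k.
have [[i fi]|nof] := pselect (exists i, f i = k); last first.
  by apply: nearW => x i fi; exfalso; apply: nof; exists i.
by apply: filterS (PF i) => x Pix i' fi'; rewrite (finj i' i) ?inE// fi fi'.
Qed.

Section JointNumbers.
Variables (R : realType) (X : normedVectType R) (dot : {dot X for idfun}).
Hypothesis hdot : norm_of_dot dot.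
Variables (c : X) (I J : Type) (A A' : I -> set X) (B B' : J -> set X).
Hypotheses (hAc : exists i, A i c) (hBc : exists j, B j c).

Local Notation joint := (joint_cq_number dot c A A' B B').
Local Notation limit := (lim_joint_cq_number dot c A A' B B').
Local Notation exactcq := (exact_joint_cq_number dot c A A' B B').

Lemma joint_cq_leP (kappa delta : R) : 0 <= kappa ->
  (joint delta <= kappa%:E)%E <->
  forall i j, angle_bound dot c (A i) (A' i) (B j) (B' j) kappa delta.
Proof.
move=> k0; split=> [/ereal_supP jk i j|bnd].
  by apply/(cq_number_leP dot _ _ _ _ _ _ k0); apply: jk; exists (i, j).
apply/ereal_supP => _ [[i j] _ <-].
by apply/(cq_number_leP dot _ _ _ _ _ _ k0); exact: bnd.
Qed.

Lemma joint_cq_mono : {homo joint : d e / d <= e >-> (d <= e)%E}.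
Proof.
move=> d e de; apply/ereal_supP => _ [p _ <-].
apply: (le_trans (cq_number_mono _ _ _ _ _ _ de)).
by apply: ereal_sup_ubound; exists p.
Qed.

Lemma joint_cq_ge0 delta : 0 <= delta -> (0 <= joint delta)%E.
Proof.
move: hAc hBc => [i Ai] [j Bj] d0.
apply: (@le_trans _ _ (cq_number dot c (A i) (A' i) (B j) (B' j) delta)).
  apply: ereal_sup_ubound; exists c, c, 0, 0; rewrite oppr0 linear0l subrr normr0.
  by split=> //; exact: prox_normal0.
by apply: ereal_sup_ubound; exists (i, j).
Qed.

Lemma joint_cq_le1 delta : (joint delta <= 1)%E.
Proof.
apply/(joint_cq_leP _ ler01) => i j x y u w _ _ _ _.
by rewrite -linearNr mul1r -(normrN w); exact: cauchy_schwarz.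
Qed.

Lemma is_cvg_joint_cq : cvg (joint delta @[delta --> 0^'+]).
Proof.
apply: nondecreasing_at_right_is_cvge; near=> x => d e _ _.
exact: joint_cq_mono.
Unshelve. all: by end_near. Qed.

Lemma lim_joint_cq_le delta : 0 < delta -> (limit <= joint delta)%E.
Proof.
move=> d0; apply: lime_le; first exact: is_cvg_joint_cq.
by near=> d; apply: joint_cq_mono; apply: ltW; near: d; exact: nbhs_right_lt.
Unshelve. all: by end_near. Qed.

Lemma lim_joint_cq_ge x : (forall delta, 0 < delta -> (x <= joint delta)%E) ->
  (x <= limit)%E.
Proof.
move=> xle; apply: lime_ge; first exact: is_cvg_joint_cq.
by near=> d; apply: xle.
Unshelve. all: by end_near. Qed.

Lemma lim_joint_cq_ge0 : (0 <= limit)%E.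
Proof. by apply: lim_joint_cq_ge => d /ltW; exact: joint_cq_ge0. Qed.

Lemma lim_joint_cq_fin_num : limit \is a fin_num.
Proof.
rewrite ge0_fin_numE ?lim_joint_cq_ge0//.
by rewrite (le_lt_trans (lim_joint_cq_le ltr01))// (le_lt_trans (joint_cq_le1 _))// ltry.
Qed.

Lemma near_joint_cq_lt x : (limit < x)%E ->
  \forall delta \near 0^'+, (joint delta < x)%E.
Proof.
move=> limx; have [d d0 jd] : exists2 d, 0 < d & (joint d < x)%E.
  apply: contrapT => nod; move: limx; apply/negP; rewrite -leNgt.
  apply: lim_joint_cq_ge => d d0; rewrite leNgt; apply/negP => jd.
  by apply: nod; exists d.
near=> e; apply: le_lt_trans jd; apply: joint_cq_mono; apply: ltW.
by near: e; exact: nbhs_right_lt.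
Unshelve. all: by end_near. Qed.

Lemma exact_joint_cq_le_lim : (exactcq <= limit)%E.
Proof.
apply: lim_joint_cq_ge => d d0.
have jfin : joint d \is a fin_num.
  rewrite ge0_fin_numE ?joint_cq_ge0 ?ltW//.
  by rewrite (le_lt_trans (joint_cq_le1 _))// ltry.
rewrite -(fineK jfin); have k0 : 0 <= fine (joint d).
  by apply: fine_ge0; exact: joint_cq_ge0 (ltW d0).
have /(joint_cq_leP d k0) bnd : (joint d <= (fine (joint d))%:E)%E.
  by rewrite fineK.
apply/ereal_supP => _ [[i j] _ <-].
exact: (exact_cq_number_le hdot k0 d0 (bnd i j)).
Qed.

(** By [cq_number_le_exact] every pair of members has a radius at which its
    CQ-number is at most [exactcq + e]; finitely many pairs have a common one. *)
Lemma lim_joint_cq_finite : finite_set [set: I] -> finite_set [set: J] ->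
  (forall i, closed (A i)) -> (forall j, closed (B j)) ->
  (exactcq < 1)%E -> limit = exactcq.
Proof.
move=> fI fJ cA cB ex1; apply/eqP; rewrite eq_le exact_joint_cq_le_lim andbT.
apply/lee_addgt0Pr => e e0.
(* 0 is a limiting normal at [c], so the exact number is not -oo *)
have exfin : exactcq \is a fin_num.
  rewrite fin_numE; apply/andP; split; last first.
    by apply/eqP => exE; move: ex1; rewrite exE.
  move: hAc hBc => [i Ai] [j Bj]; rewrite -ltNye.
  apply: (@lt_le_trans _ _ 0%E); first exact: ltNy0.
  apply: (@le_trans _ _ (exact_cq_number dot c (A i) (A' i) (B j) (B' j))).
    apply: ereal_sup_ubound; exists 0, 0; rewrite oppr0 linear0l normr0.
    by split=> //; (split => //; exists (fun=> c), (fun=> 0); split=> [//| n | |];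
      [exact: prox_normal0|exact: cvg_cst|exact: cvg_cst]).
  by apply: ereal_sup_ubound; exists (i, j).
have : \forall d \near 0^'+, forall p : I * J,
    (cq_number dot c (A p.1) (A' p.1) (B p.2) (B' p.2) d <= exactcq + e%:E)%E.
  apply: near_finite_forall => [|[i j]].
    by rewrite -setXTT; exact: finite_setX.
  have [|d d0 cqd] := @cq_number_le_exact _ _ dot hdot c (A i) (A' i) (B j) (B' j)
      (fine exactcq + e) (cA i) (cB j).
    rewrite EFinD fineK//; apply: (@le_lt_trans _ _ exactcq).
      by apply: ereal_sup_ubound; exists (i, j).
    by rewrite lteDl.
  move: cqd; rewrite EFinD fineK// => cqd.
  near=> d'; apply: le_trans cqd; apply: cq_number_mono; apply: ltW.
  by near: d'; exact: nbhs_right_lt.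
move=> h; have [d [d0 hd]] : exists d, 0 < d /\ forall p : I * J,
    (cq_number dot c (A p.1) (A' p.1) (B p.2) (B' p.2) d <= exactcq + e%:E)%E.
  near (0 : R)^'+ => d; exists d; split => //.
  by near: d; exact: h.
apply: (le_trans (lim_joint_cq_le d0)).
by apply/ereal_supP => _ [p _ <-]; exact: hd.
Unshelve. all: by end_near. Qed.

End JointNumbers.

(** * Sequences with geometrically decreasing increments *)

Section GeometricSequences.
Variables (R : realType) (X : normedVectType R).

Lemma cluster_norm_le (x : nat -> X) p y (r : R) n : cluster (x @ \oo) p ->
  (forall m, (n <= m)%N -> `|x m - y| <= r) -> `|p - y| <= r.
Proof.
move=> clp xr; apply: (@closed_norm_le _ _ y r) => B pB.
by apply: clp => //; exists n.
Qed.

(** The increments are only assumed to decrease while the sequence stays within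
    [rho] of [x 0]. It never leaves that ball, because the geometric series of
    the increments sums to at most [rho]. The limit is obtained as a cluster
    point, which exists by compactness, and the bound on the tails passes to
    it. *)
Lemma geometric_sequence (x : nat -> X) (theta rho : R) :
  0 <= theta -> theta < 1 -> 0 <= rho ->
  `|x 1%N - x 0%N| <= (1 - theta) * rho ->
  (forall k, `|x k - x 0%N| <= rho -> `|x k.+1 - x 0%N| <= rho ->
     `|x k.+2 - x k.+1| <= theta * `|x k.+1 - x k|) ->
  exists p, forall k, `|x k - p| <= rho * theta ^+ k.
Proof.
move=> th0 th1 rho0 x10 step.
have thk0 k : 0 <= theta ^+ k by rewrite exprn_ge0.
(* [(1 - theta ^+ k) * rho] is a partial sum of the geometric series *)
have main k : `|x k - x 0%N| <= (1 - theta ^+ k) * rho /\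
              `|x k.+1 - x k| <= theta ^+ k * ((1 - theta) * rho).
  have near0 m : `|x m - x 0%N| <= (1 - theta ^+ m) * rho -> `|x m - x 0%N| <= rho.
    by move=> /le_trans; apply; rewrite ler_piMl// gerBl.
  have next m : `|x m - x 0%N| <= (1 - theta ^+ m) * rho ->
      `|x m.+1 - x m| <= theta ^+ m * ((1 - theta) * rho) ->
      `|x m.+1 - x 0%N| <= (1 - theta ^+ m.+1) * rho.
    move=> h1 h2; have := lerD h2 h1; have := ler_normD (x m.+1 - x m) (x m - x 0%N).
    by rewrite subrKA exprS; nra.
  elim: k => [|k [IH1 IH2]].
    by rewrite expr0 !subrr mul0r mul1r normr0.
  split; first exact: next.
  apply: (le_trans (step _ (near0 _ IH1) (near0 _ (next _ IH1 IH2)))).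
  by rewrite exprS -mulrA ler_wpM2l.
have tail k m : (k <= m)%N -> `|x m - x k| <= rho * (theta ^+ k - theta ^+ m).
  move=> /subnKC <-; elim: (m - k)%N => [|d IHd].
    by rewrite addn0 !subrr normr0 mulr0.
  rewrite addnS; have := lerD (main (k + d)%N).2 IHd.
  have := ler_normD (x (k + d).+1 - x (k + d)%N) (x (k + d)%N - x k).
  rewrite subrKA exprS; nra.
have [|p [_ clp]] := @compact_norm_le _ X (x 0%N) rho (x @ \oo) _.
  exists 0%N => // k _ /=; apply: (le_trans (main k).1).
  by rewrite ler_piMl// gerBl.
exists p => // k; rewrite distrC; apply: (cluster_norm_le (n := k) clp) => m km.
by apply: (le_trans (tail k m km)); rewrite ler_wpM2l// gerBl.
Qed.

End GeometricSequences.

(** * One step of the method *)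

Section Contraction.
Variables (R : realType) (X : normedVectType R) (dot : {dot X for idfun}).
Hypothesis hdot : norm_of_dot dot.

(** Both [a] and [a'] must lie in [C]: its regularity at [a'] controls the chord
    from [a'] to [a], while the CQ-number controls the angle between the normals
    [b - a'] at [a'] and [a - b] at [b]. *)
Lemma member_contraction (c : X) (C C' D D' E : set X) (kappa eps delta : R)
    (a b a' : X) :
  0 <= kappa -> 0 <= eps ->
  regular dot C E eps delta c -> D' `<=` E ->
  angle_bound dot c C C' D D' kappa delta ->
  C a -> C' a -> D' b -> proj D a b -> proj C b a' ->
  `|a - c| <= delta -> `|b - c| <= delta -> `|a' - c| <= delta ->
  `|b - a'| <= (kappa + 2 * eps) * `|a - b|.
Proof.
move=> k0 eps0 reg D'E ang Ca C'a D'b ab ba' ac bc a'c.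
have nu := prox_normal_proj D'b ba'.
have h1 := ang _ _ _ _ nu (prox_normal_proj C'a ab) a'c bc.
have Ca' : C a' by case: ba'.
have h2 := reg a a' _ Ca Ca' ac a'c (prox_normal_subset D'E nu).
have le1 : `|b - a'| <= `|a - b|.
  by rewrite (distrC a); case/projP: ba' => _; apply.
have le2 : `|a - a'| <= 2 * `|a - b|.
  by have := ler_normD (a - b) (b - a'); rewrite subrKA; lra.
have [->|u0] := eqVneq (b - a') 0.
  by rewrite normr0 mulr_ge0// addr_ge0// mulr_ge0.
have nu0 : 0 < `|b - a'| by rewrite normr_gt0.
(* [b - a'] is the sum of [b - a] and [a - a'] *)
have e1 : dot (b - a') (b - a') = - dot (b - a') (a - b) + dot (b - a') (a - a').
  by rewrite -linearNr -dotDr opprB addrA subrK.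
have h3 : eps * `|b - a'| * `|a - a'| <= eps * `|b - a'| * (2 * `|a - b|).
  by rewrite ler_wpM2l// mulr_ge0.
rewrite -(ler_pM2l nu0); move: e1; rewrite hdot expr2.
by lra.
Qed.

Lemma angle_bound_sym (c : X) C C' D D' (kappa delta : R) :
  angle_bound dot c C C' D D' kappa delta -> angle_bound dot c D D' C C' kappa delta.
Proof.
move=> bnd y x w u nw nu yc xc; rewrite dotC mulrAC; exact: (bnd x y u w).
Qed.

(** [n], [o], [p], [q], [r] are consecutive iterates. If [q] lies in the first
    union then [r = q]. If not, none of the preceding projections is trivial, so
    [o] and [p] are boundary points outside the other union. Hence [p], a
    projection of [o], is in [A' i] as soon as it is in [A i], and [q], a
    projection of [p], is in [B' j] as soon as it is in [B j]. *)
Lemma alternating_contraction (c : X) (I J : Type) (A A' : I -> set X)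
    (B B' : J -> set X) (kappa eps delta : R) (n o p q r : X) :
  0 <= kappa -> 0 <= eps ->
  (forall i, closed (A i)) ->
  (forall i, proj_set (A i) (bdry (\bigcup_j B j) `\` \bigcup_i A i) `<=` A' i) ->
  (forall j, proj_set (B j) (bdry (\bigcup_i A i) `\` \bigcup_j B j) `<=` B' j) ->
  joint_regular dot A (\bigcup_j B' j) eps (3 * delta) c ->
  (forall i j, angle_bound dot c (A i) (A' i) (B j) (B' j) kappa (3 * delta)) ->
  (\bigcup_i A i) n -> proj (\bigcup_j B j) n o -> proj (\bigcup_i A i) o p ->
  proj (\bigcup_j B j) p q -> proj (\bigcup_i A i) q r ->
  `|p - c| <= delta -> `|q - c| <= delta ->
  `|r - q| <= (kappa + 2 * eps) * `|q - p|.
Proof.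
move=> k0 eps0 cA hPA hPB regA ang An no op pq qr pc qc.
have th0 : 0 <= kappa + 2 * eps by rewrite addr_ge0// mulr_ge0.
have [Bo Ap Bq] : [/\ (\bigcup_j B j) o, (\bigcup_i A i) p & (\bigcup_j B j) q].
  by split; [case: no|case: op|case: pq].
have [Aq|nAq] := pselect ((\bigcup_i A i) q).
  by rewrite (proj_id Aq qr) subrr normr0 mulr_ge0.
have nBp : ~ (\bigcup_j B j) p.
  by move=> Bp; apply: nAq; rewrite (proj_id Bp pq).
have nAo : ~ (\bigcup_i A i) o.
  by move=> Ao; apply: nBp; rewrite (proj_id Ao op).
have nBn : ~ (\bigcup_j B j) n.
  by move=> Bn; apply: nAo; rewrite (proj_id Bn no).
have [i _ Aip] := Ap; have [j _ Bjq] := Bq.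
have sub_A : A i `<=` \bigcup_i A i by move=> z Aiz; exists i.
have sub_B : B j `<=` \bigcup_j B j by move=> z Bjz; exists j.
have A'p : A' i p.
  apply: hPA; exists o; first by split => //; exact: proj_bdry nBn no.
  exact: proj_subset op.
have pjq : proj (B j) p q by exact: proj_subset pq.
have B'q : B' j q.
  by apply: hPB; exists p => //; split => //; exact: proj_bdry nAo op.
(* [r] may lie in another member than [p]; [p'] is in the same one *)
have [||p' qp'] := @proj_exists _ _ (A i) q; [by exists p|exact: cA|].
have Ap' : (\bigcup_i A i) p' by apply: sub_A; case: qp'.
have qp'p : `|q - p'| <= `|p - q|.
  by rewrite (distrC p); case/projP: qp' => _; apply.
have d0 : 0 <= delta := le_trans (normr_ge0 _) pc.
apply: (@le_trans _ _ `|q - p'|).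
  by rewrite distrC; case/projP: qr => _; apply.
rewrite (distrC q p).
apply: (member_contraction k0 eps0 (regA i) _ (ang i j) Aip A'p B'q pjq qp').
- by move=> z B'z; exists j.
- lra.
- lra.
have := ler_normD (p' - q) (q - c); rewrite subrKA (distrC p' q).
have := ler_normD (p - c) (c - q); rewrite subrKA (distrC c q).
lra.
Qed.

End Contraction.

(** * Convergence of the method *)

Section AlternatingProjections.
Variables (R : realType) (X : normedVectType R) (dot : {dot X for idfun}).
Hypothesis hdot : norm_of_dot dot.

Lemma closed_geometric_lim (C : set X) (z : nat -> X) p (M gamma : R) :
  closed C -> 0 <= gamma < 1 -> (forall n, C (z n)) ->
  (forall n, `|z n - p| <= M * gamma ^+ n) -> C p.
Proof.
move=> cC /andP[g0 g1] Cz zp; apply: (@closed_cvg _ _ \oo _ z C cC (nearW _ Cz)).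
apply/cvgrPdist_le => e e0.
have : M * gamma ^+ n @[n --> \oo] --> M * 0.
  by apply: cvgMl_tmp; apply: cvg_expr; rewrite ger0_norm.
rewrite mulr0 => /cvgr0_norm_le/(_ _ e0); apply: filterS => n.
by apply: le_trans; rewrite distrC; apply: (le_trans (zp n)); exact: ler_norm.
Qed.

(** A bound from index 1 on extends to index 0 by enlarging the constant. *)
Lemma converges_linearly_of_shift (z : nat -> X) p (M gamma : R) :
  0 < gamma < 1 -> 0 <= M ->
  (forall n, `|z n.+1 - p| <= M * gamma ^+ n) -> converges_linearly z p gamma.
Proof.
move=> /andP[g0 g1] M0 zp; split; first by rewrite ltW.
exists (`|z 0%N - p| + M / gamma).
  by rewrite addr_ge0// divr_ge0// ltW.
case=> [|n]; first by rewrite expr0 mulr1 lerDl divr_ge0// ltW.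
apply: (le_trans (zp n)).
rewrite mulrDl [in X in _ + X]exprS [in X in _ + X]mulrA divfK ?gt_eqF//.
by rewrite lerDr mulr_ge0// exprn_ge0// ltW.
Qed.

(** The geometric sequence is [a 1], [b 1], [a 2], ..., because the contraction
    at [p] needs two iterates before [p]. *)
Lemma alternating_projections_cvg (c : X) (I J : Type) (A A' : I -> set X)
    (B B' : J -> set X) (kappa eps theta delta : R) (start : X) (a b : nat -> X) :
  0 <= kappa -> 0 <= eps -> 0 < theta < 1 -> kappa + 2 * eps <= theta -> 0 < delta ->
  (forall i, closed (A i)) -> (forall j, closed (B j)) ->
  closed (\bigcup_i A i) -> closed (\bigcup_j B j) ->
  ((\bigcup_i A i) `&` (\bigcup_j B j)) c ->
  (forall i, proj_set (A i) (bdry (\bigcup_j B j) `\` \bigcup_i A i) `<=` A' i) ->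
  (forall j, proj_set (B j) (bdry (\bigcup_i A i) `\` \bigcup_j B j) `<=` B' j) ->
  joint_regular dot A (\bigcup_j B' j) eps (3 * delta) c ->
  joint_regular dot B (\bigcup_i A' i) eps (3 * delta) c ->
  (forall i j, angle_bound dot c (A i) (A' i) (B j) (B' j) kappa (3 * delta)) ->
  `|start - c| <= (1 - theta) * delta / (6 * (2 - theta)) ->
  alternating_projections (\bigcup_i A i) (\bigcup_j B j) start a b ->
  exists cbar : X,
    [/\ ((\bigcup_i A i) `&` (\bigcup_j B j)) cbar, `|cbar - c| <= delta &
        forall n, `|a n.+1 - cbar| <= delta / (2 - theta) * (theta ^+ 2) ^+ n /\
                  `|b n.+1 - cbar| <= delta / (2 - theta) * (theta ^+ 2) ^+ n].
Proof.
move=> k0 eps0 /andP[th0 th1] kth d0 cA cB cUA cUB [Ac Bc] hPA hPB regA regB ang.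
set t := delta / (2 - theta) => start_c ab.
have th2 : 2 - theta != 0 by rewrite gt_eqF// subr_gt0 (lt_trans th1)// ltr1n.
have dE : delta = t * (2 - theta) by rewrite /t divfK.
have t0 : 0 < t by rewrite divr_gt0// subr_gt0 (lt_trans th1)// ltr1n.
have {}start_c : `|start - c| <= (1 - theta) * t / 6.
  rewrite (le_trans start_c)// le_eqVlt; apply/orP; left; apply/eqP.
  by rewrite /t; field.
clearbody t.
have pb n : proj (\bigcup_j B j) (a n) (b n) by exact: (ab n).2.
have pa n : proj (\bigcup_i A i) (b n) (a n.+1) by exact: (ab n.+1).1.
have Aa n : (\bigcup_i A i) (a n) by case: (ab n) => -[].
have Bb n : (\bigcup_j B j) (b n) by case: (pb n).
(* the first iterates stay near [c], as [c] competes in every projection *)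
have a0c : `|start - a 0%N| <= `|start - c|.
  by have [/projP[_ +] _] := ab 0%N; apply.
have b0a0 : `|a 0%N - b 0%N| <= `|a 0%N - c| by have /projP[_] := pb 0%N; apply.
have a1b0 : `|b 0%N - a 1%N| <= `|b 0%N - a 0%N| by have /projP[_] := pa 0%N; apply.
have b1a1 : `|a 1%N - b 1%N| <= `|a 1%N - b 0%N| by have /projP[_] := pb 1%N; apply.
have a0c2 : `|a 0%N - c| <= (1 - theta) * t / 3.
  have := ler_normD (a 0%N - start) (start - c); rewrite subrKA (distrC (a 0%N) start); lra.
have a1c : `|a 1%N - c| <= (1 - theta) * t.
  have := ler_normD (a 1%N - b 0%N) (b 0%N - c); rewrite subrKA (distrC (a 1%N) (b 0%N)).
  have := ler_normD (b 0%N - a 0%N) (a 0%N - c); rewrite subrKA.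
  by rewrite (distrC (a 0%N) (b 0%N)) in b0a0; lra.
have b1a1' : `|b 1%N - a 1%N| <= (1 - theta) * (t / 3).
  by rewrite (distrC (b 1%N)) (le_trans b1a1)// distrC (le_trans a1b0)// distrC
    (le_trans b0a0)// mulrA.
(* the radius [t / 3] makes [(1 - theta) * (t / 3)] the bound on the first step *)
pose x k := if odd k then b k./2.+1 else a k./2.+1.
have xa k : x k.*2 = a k.+1 by rewrite /x odd_double doubleK.
have xb k : x k.*2.+1 = b k.+1 by rewrite /x /= odd_double /= uphalf_double.
have [||||k xk xk1|p xp] := @geometric_sequence _ _ x theta (t / 3).
- exact: ltW.
- by [].
- by rewrite divr_ge0// ltW.
- exact: b1a1'.
- have xc m : `|x m - x 0%N| <= t / 3 -> `|x m - c| <= delta.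
    move=> xm; have := ler_normD (x m - x 0%N) (x 0%N - c); rewrite subrKA.
    by rewrite [x 0%N]/= /x /= -/x in xm *; nra.
  move: (xc _ xk) (xc _ xk1) => {}xk {}xk1.
  apply: (@le_trans _ _ ((kappa + 2 * eps) * `|x k.+1 - x k|)); last first.
    by rewrite ler_wpM2r.
  (* for odd [k] the two collections exchange their roles *)
  rewrite -(odd_double_half k) in xk xk1 *.
  case: (odd k) xk xk1; rewrite ?add1n ?add0n -?doubleS ?xb ?xa -?doubleS ?xb ?xa => xk xk1.
  + have ang' j i := angle_bound_sym (ang i j).
    exact: (alternating_contraction hdot k0 eps0 cB hPB hPA regB ang'
      (Bb _) (pa _) (pb _) (pa _) (pb _) xk xk1).
  + exact: (alternating_contraction hdot k0 eps0 cA hPA hPB regA ang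
      (Aa _) (pb _) (pa _) (pb _) (pa _) xk xk1).
have th21 : 0 <= theta ^+ 2 < 1.
  by rewrite exprn_ge0 ?ltW//= expr_lt1// ltW.
have ap n : `|a n.+1 - p| <= t / 3 * (theta ^+ 2) ^+ n.
  by rewrite -xa -exprM mul2n.
have bp n : `|b n.+1 - p| <= t / 3 * (theta ^+ 2) ^+ n.
  rewrite -xb; apply: (le_trans (xp _)); rewrite ler_wpM2l ?divr_ge0 ?(ltW t0)//.
  rewrite -exprM mul2n; apply: ler_wiXn2l; rewrite ?leqnSn//; exact: ltW.
have weaken n : t / 3 * (theta ^+ 2) ^+ n <= t * (theta ^+ 2) ^+ n.
  by rewrite ler_wpM2r ?exprn_ge0 ?ltW//; lra.
exists p; split.
- split; first exact: (closed_geometric_lim cUA th21 (fun n => Aa n.+1) ap).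
  exact: (closed_geometric_lim cUB th21 (fun n => Bb n.+1) bp).
- have := ler_normD (p - a 1%N) (a 1%N - c); rewrite subrKA (distrC p (a 1%N)).
  by have := ap 0%N; rewrite expr0 mulr1; nra.
- by move=> n; split; exact: le_trans (weaken n).
Qed.

End AlternatingProjections.

(** * A common radius of regularity *)

Section UniformRegularity.
Variables (R : realType) (X : normedVectType R) (dot : {dot X for idfun}).

Lemma regular_le (D E : set X) (eps d e : R) (c : X) :
  d <= e -> regular dot D E eps e c -> regular dot D E eps d c.
Proof.
move=> de reg y b u Dy Db yc bc nu.
by apply: reg => //; [exact: le_trans de|exact: le_trans de].
Qed.

Lemma near_joint_regular (I : Type) (A : I -> set X) (E : set X) (c : X) (eps : R) :
  0 < eps -> joint_superregular dot A E c ->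
  finite_set [set: I] \/ uniformly_joint_superregular dot A E c ->
  \forall delta \near 0^'+, joint_regular dot A E eps delta c.
Proof.
move=> eps0 sA [fI|/(_ _ eps0)[d d0 regA]]; last first.
  near=> e => i; apply: regular_le (regA i); apply: ltW.
  by near: e; exact: nbhs_right_lt.
apply: near_finite_forall fI _ => i; have [d d0 regA] := sA i _ eps0.
near=> e; apply: regular_le regA; apply: ltW.
by near: e; exact: nbhs_right_lt.
Unshelve. all: by end_near. Qed.

End UniformRegularity.

Unset Implicit Arguments.
Set Strict Implicit.
Set Printing Implicit Defensive.

(** * The theorem *)

Theorem theorem10p17 (R : realType) (X : normedVectType R)
  (dot : {dot X for idfun}) (hdot : norm_of_dot dot)
  (I J : Type) (hI : [set: I] !=set0) (hJ : [set: J] !=set0)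
  (A A' : I -> set X) (B B' : J -> set X) (c : X)
  (hA : forall i, A i !=set0 /\ closed (A i))
  (hB : forall j, B j !=set0 /\ closed (B j))
  (hUA : closed (\bigcup_i A i)) (hUB : closed (\bigcup_j B j))
  (hc : ((\bigcup_i A i) `&` (\bigcup_j B j)) c)
  (hA' : forall i, A' i !=set0) (hB' : forall j, B' j !=set0)
  (hPA : forall i,
     proj_set (A i) (bdry (\bigcup_j B j) `\` \bigcup_i A i) `<=` A' i)
  (hPB : forall j,
     proj_set (B j) (bdry (\bigcup_i A i) `\` \bigcup_j B j) `<=` B' j)
  (hsA : joint_superregular dot A (\bigcup_j B' j) c)
  (hsB : joint_superregular dot B (\bigcup_i A' i) c)
  (hab : (lim_joint_cq_number dot c A A' B B' < 1%:E)%E \/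
         [/\ finite_set [set: I], finite_set [set: J] &
             (exact_joint_cq_number dot c A A' B B' < 1%:E)%E]) :
  let thetabar := lim_joint_cq_number dot c A A' B B' in
  let alphabar := exact_joint_cq_number dot c A A' B B' in
  ([/\ finite_set [set: I], finite_set [set: J] & (alphabar < 1%:E)%E] ->
     thetabar = alphabar /\ (thetabar < 1%:E)%E) /\
  forall theta : R, (thetabar < theta%:E)%E -> theta < 1 ->
  let eps := (theta - fine thetabar) / 3 in
  let good (delta : R) :=
    [/\ 0 < delta,
        joint_regular dot A (\bigcup_j B' j) eps (3 * delta) c,
        joint_regular dot B (\bigcup_i A' i) eps (3 * delta) c &
        [/\ (joint_cq_number dot c A A' B B' (3 * delta)%R
               < thetabar + eps%:E)%E,
            (thetabar + eps%:E)%E = (theta - 2 * eps)%:E &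
            theta - 2 * eps < 1 - 2 * eps]] in
  ((finite_set [set: I] \/
      uniformly_joint_superregular dot A (\bigcup_j B' j) c) ->
   (finite_set [set: J] \/
      uniformly_joint_superregular dot B (\bigcup_i A' i) c) ->
   exists delta, good delta) /\
  forall delta : R, good delta ->
  forall start : X,
    `|start - c| <= (1 - theta) * delta / (6 * (2 - theta)) ->
  forall a b : nat -> X,
    alternating_projections (\bigcup_i A i) (\bigcup_j B j) start a b ->
  exists cbar : X,
    [/\ ((\bigcup_i A i) `&` (\bigcup_j B j)) cbar, `|cbar - c| <= delta,
        converges_linearly a cbar (theta ^+ 2),
        converges_linearly b cbar (theta ^+ 2) &
        forall n : nat, (1 <= n)%N ->
          Num.max `|a n - cbar| `|b n - cbar|
            <= delta / (2 - theta) * (theta ^+ 2) ^+ n.-1].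
Proof.
move=> thetabar alphabar.
have hAc : exists i, A i c by have [[i _ Ai] _] := hc; exists i.
have hBc : exists j, B j c by have [_ [j _ Bj]] := hc; exists j.
have cA i : closed (A i) by case: (hA i).
have cB j : closed (B j) by case: (hB j).
have tfin : thetabar \is a fin_num by exact: lim_joint_cq_fin_num.
have tge0 : 0 <= fine thetabar.
  by apply: fine_ge0; exact: lim_joint_cq_ge0.
split=> [[fI fJ alpha1]|theta ttheta theta1 eps good].
  have talpha : thetabar = alphabar by exact: lim_joint_cq_finite.
  by rewrite talpha.
have eps0 : 0 < eps.
  by rewrite divr_gt0// subr_gt0 -lte_fin fineK.
have tE : (thetabar + eps%:E)%E = (theta - 2 * eps)%:E.
  by rewrite -(fineK tfin) -EFinD /eps; congr EFin; field.
split=> [uA uB|delta [d0 regA regB [jlt _ _]] start start_c a b ab].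
  have [e [e0 regA regB jlt]] : exists e, [/\ 0 < e,
      joint_regular dot A (\bigcup_j B' j) eps e c,
      joint_regular dot B (\bigcup_i A' i) eps e c &
      (joint_cq_number dot c A A' B B' e < thetabar + eps%:E)%E].
    near (0 : R)^'+ => e; exists e; split=> //.
    - by near: e; exact: near_joint_regular.
    - by near: e; exact: near_joint_regular.
    - near: e; apply: near_joint_cq_lt => //.
      by rewrite lteDl.
  have e3 : 3 * (e / 3) = e by field.
  exists (e / 3); rewrite /good e3; split=> //; first by rewrite divr_gt0.
  by split=> //; rewrite ltrD2r.
have jle : (joint_cq_number dot c A A' B B' (3 * delta)%R <= (theta - 2 * eps)%:E)%E.
  by rewrite -tE ltW.
have k0 : 0 <= theta - 2 * eps.
  rewrite -lee_fin; apply: le_trans jle; apply: joint_cq_ge0 => //.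
  by rewrite mulr_ge0// ltW.
have th01 : 0 < theta < 1 by rewrite theta1 andbT; lra.
have kth : theta - 2 * eps + 2 * eps <= theta by rewrite subrK.
have ang := (joint_cq_leP dot c A A' B B' _ k0).1 jle.
have [p [ABp pc abp]] := alternating_projections_cvg hdot k0 (ltW eps0) th01 kth d0
  cA cB hUA hUB hc hPA hPB regA regB ang start_c ab.
have [th0 _] := andP th01.
have th2 : 0 < theta ^+ 2 < 1 by rewrite exprn_gt0//= expr_lt1// ltW.
have M0 : 0 <= delta / (2 - theta) by rewrite divr_ge0 ?ltW// subr_gt0; lra.
exists p; split=> //.
- by apply: (converges_linearly_of_shift th2 M0) => n; case: (abp n).
- by apply: (converges_linearly_of_shift th2 M0) => n; case: (abp n).
by case=> // n _; rewrite ge_max; have [-> ->] := abp n.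
Unshelve. all: by end_near. Qed.
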